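(* For every integer $n\geq 4$, the subgroup $G=\{\sigma\in\mathcal S_n\mid \sigma(2)=2\}$ of $\mathcal S_n$ (which is isomorphic to $\mathcal S_{n-1}$) is nudgable. In particular, for $n=4$ this is a nudgable subgroup of $\mathcal S_4$ with $6$ elements. Moreover this is the smallest possible order of a nudgable subgroup: for every $m\geq 1$, every subgroup of $\mathcal S_m$ with fewer than $6$ elements is non-nudgable.
   Context: $\mathcal S_n$ denotes the group of all permutations of $\{1,\ldots,n\}$. For $\sigma\in\mathcal S_n$ the inversion set is $\mathrm{inv}(\sigma)=\{(i,j)\mid 1\leq i<j\leq n,\ \sigma(j)<\sigma(i)\}$. For a subgroup $G\subseteq\mathcal S_n$ and $\pi\in G$ put $D_G(\pi)=\{\sigma\in G\mid \mathrm{inv}(\sigma)\cap\mathrm{inv}(\pi)=\emptyset\}$. The subgroup $G\subseteq\mathcal S_n$ is called non-nudgable if $|D_G(\pi)|=|D_G(\pi^{-1})|$ for all $\pi\in G$; otherwise it is called nudgable. *)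

(* Defs.v *)
From mathcomp Require Import all_boot all_fingroup.
Set Implicit Arguments.
Unset Strict Implicit.
Unset Printing Implicit Defensive.

Import GroupScope.

(* S_n is 'S_n, acting on 'I_n = {0, ..., n-1}: the point k of {1, ..., n} is the
   ordinal of value k-1. MathComp composes permutations left to right, which
   affects neither the subgroups of S_n nor inverses. *)

Definition inversions (n : nat) (s : 'S_n) : {set 'I_n * 'I_n} :=
  [set p : 'I_n * 'I_n | (p.1 < p.2)%N && (s p.2 < s p.1)%N].

Definition inv_disjoint (n : nat) (G : {group 'S_n}) (p : 'S_n) : {set 'S_n} :=
  [set s in G | inversions s :&: inversions p == set0].

Definition non_nudgable (n : nat) (G : {group 'S_n}) : Prop :=
  forall p : 'S_n, p \in G -> #|inv_disjoint G p| = #|inv_disjoint G p^-1|.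

Definition nudgable (n : nat) (G : {group 'S_n}) : Prop := ~ non_nudgable G.

Definition point_stab (n : nat) (x : 'I_n) : {set 'S_n} :=
  [set s : 'S_n | s x == x].

Lemma point_stab_group_set (n : nat) (x : 'I_n) : group_set (point_stab x).
Proof.
apply/group_setP; split=> [|s t]; first by rewrite inE perm1.
by rewrite !inE permM => /eqP-> /eqP->.
Qed.

Canonical point_stab_group (n : nat) (x : 'I_n) : {group 'S_n} :=
  Group (point_stab_group_set x).

(* The point 2 of {1, ..., n} is the ordinal of value 1. *)
Definition point2 (n : nat) (hn : (4 <= n)%N) : 'I_n :=
  Ordinal (ltnW (ltnW hn) : (1 < n)%N).

(* Main.v *)
(** Call an ordered pair (i, j) reversed by [s] when [s] changes the truth value
    of i < j.  The pairs on which [s] and [t] disagree are in bijection with the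
    pairs reversed by s^-1 t, so the number of pairs reversed by both is
    determined by the numbers of pairs reversed by [s], [t] and s^-1 t.  Inversion
    preserves these numbers when [s] and [t] commute, hence abelian groups are
    non-nudgable, and every group of order less than 6 is abelian.

    For the stabiliser of 2, take the 3-cycle a = (1 3 4).  Elements of D(a) and
    of D(a^-1) do not invert (1, 2), so they fix 1 as well as 2.  The inversions
    of a^-1 = (1 4 3) all involve 1 or 2, so nothing else is required for D(a^-1);
    but [a] inverts (3, 4), so D(a) misses the transposition (3 4). *)

Require Import Defs.
From mathcomp Require Import all_boot all_fingroup.
From mathcomp Require Import all_solvable.

Set Implicit Arguments.
Unset Strict Implicit.

Import GroupScope.

Section Reversals.

Variable n : nat.
Implicit Types s t : 'S_n.

(** Both orders of a pair are kept, so each inversion counts twice; in exchange, a permutation can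
    relabel the pairs without re-sorting them. *)
Definition reversals s : {set 'I_n * 'I_n} :=
  [set p : 'I_n * 'I_n | (p.1 < p.2)%N (+) (s p.1 < s p.2)%N].

Lemma in_reversals s i j :
  ((i, j) \in reversals s) = (i < j)%N (+) (s i < s j)%N.
Proof. by rewrite inE. Qed.

Lemma disjoint_inversions_reversals s t :
  (inversions s :&: inversions t == set0)
    = (reversals s :&: reversals t == set0).
Proof.
apply/set0Pn/set0Pn => -[[i j]]; rewrite inE.
- rewrite /inversions !inE /= => /andP[/andP[ij sji] /andP[_ tji]].
  exists (i, j); rewrite inE !in_reversals ij.
  by rewrite !ltnNge (ltnW sji) (ltnW tji).
- rewrite !in_reversals => /andP[].
  have neq (u : 'S_n) : i != j -> val (u i) != val (u j).
    by move=> ij; rewrite val_eqE (inj_eq perm_inj).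
  have [-> | ij] := eqVneq i j; first by rewrite !ltnn.
  have := neq s ij; have := neq t ij.
  have ijv : val i != val j by rewrite val_eqE.
  case: (ltngtP i j) ijv => // lt_ij _; case: (ltngtP (s i) (s j)) => //;
    case: (ltngtP (t i) (t j)) => // lt_t lt_s _ _ _ _.
  + by exists (i, j); rewrite /inversions !inE /= lt_ij lt_s lt_t.
  + by exists (j, i); rewrite /inversions !inE /= lt_ij lt_s lt_t.
Qed.

(** The bijection is [(i, j)] to [(s i, s j)]: with left-to-right products, [s^-1 * t] sends [s i]
    to [t i]. *)
Lemma card_disagreements s t :
  #|[set p : 'I_n * 'I_n | (s p.1 < s p.2)%N (+) (t p.1 < t p.2)%N]|
    = #|reversals (s^-1 * t)|.
Proof.
pose f (p : 'I_n * 'I_n) := (s p.1, s p.2).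
have f_inj : injective f by move=> [i j] [k l] [/perm_inj-> /perm_inj->].
rewrite -(card_imset _ f_inj); congr #|pred_of_set _|; apply/setP=> -[i j].
have -> : (i, j) = f (s^-1 i, s^-1 j) by rewrite /f /= !permKV.
by rewrite mem_imset // /f in_reversals inE /= !permM !permK.
Qed.

Lemma card_reversalsV s : #|reversals s^-1| = #|reversals s|.
Proof.
rewrite -[s^-1]mulg1 -card_disagreements; apply: eq_card => -[i j].
by rewrite in_reversals !inE !perm1 /= addbC.
Qed.

(** The disagreement set of [s] and [t] is the symmetric difference of their reversal sets. *)
Lemma card_reversals_inter s t :
  (#|reversals (s^-1 * t)| + 2 * #|reversals s :&: reversals t|
    = #|reversals s| + #|reversals t|)%N.
Proof.
rewrite -card_disagreements -cardsUI mul2n -addnn addnA; congr (_ + _)%N.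
rewrite -cardsUI [X in (_ + X)%N](_ : _ = 0%N).
  rewrite addn0; apply: eq_card => -[i j]; rewrite !inE /=.
  by do 3!case: (_ < _)%N.
apply/eqP; rewrite cards_eq0; apply/eqP/setP=> -[i j]; rewrite !inE /=.
by do 3!case: (_ < _)%N.
Qed.

Lemma card_reversals_interV s t : commute s t ->
  #|reversals s^-1 :&: reversals t^-1| = #|reversals s :&: reversals t|.
Proof.
move=> cst; apply/eqP; rewrite -(eqn_pmul2l (isT : 0 < 2)%N).
rewrite -(eqn_add2l #|reversals (s^-1 * t)|) card_reversals_inter.
rewrite -[in X in X == _](card_reversalsV (_ * _)) invMg invgK.
(* Commutation gives the inverse of [s^-1 * t] the shape needed to apply the counting identity to
   [s^-1] and [t^-1]. *)
have -> : t^-1 * s = s^-1^-1 * t^-1.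
  by rewrite invgK; apply/esym; apply: commuteV.
by rewrite card_reversals_inter !card_reversalsV.
Qed.

(** Inversion itself maps [inv_disjoint G p] bijectively onto [inv_disjoint G p^-1]. *)
Lemma abelian_non_nudgable (G : {group 'S_n}) : abelian G -> non_nudgable G.
Proof.
move=> /centsP abG p Gp; rewrite -(card_imset (inv_disjoint G p) invg_inj).
apply: eq_card => s; rewrite -[s]invgK (mem_imset _ _ invg_inj) !inE !groupV.
case Gs: (s \in G) => //=; rewrite !disjoint_inversions_reversals.
rewrite -!cards_eq0 [in RHS]card_reversals_interV //.
by apply: (abG _ _ _ Gp); rewrite groupV.
Qed.

End Reversals.

Lemma card_lt6_abelian (gT : finGroupType) (G : {group gT}) :
  (#|G| < 6)%N -> abelian G.
Proof.
case oG: #|G| => [|[|[|[|[|[|k]]]]]] // _.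
- by have := cardG_gt0 G; rewrite oG.
- by rewrite (card1_trivg oG) abelian1.
- by apply/cyclic_abelian/prime_cyclic; rewrite oG.
- by apply/cyclic_abelian/prime_cyclic; rewrite oG.
- by apply: (@card_p2group_abelian _ 2).
- by apply/cyclic_abelian/prime_cyclic; rewrite oG.
Qed.

Lemma point_stab_isog (n : nat) (x : 'I_n) : point_stab x \isog [set: 'S_n.-1].
Proof.
case: n x => [[]//|n] x /=; rewrite isog_sym.
have liftM : {in [set: 'S_n] &, {morph lift_perm x x : s t / s * t}}.
  by move=> s t _ _; rewrite lift_permM.
apply/isogP; exists (Morphism liftM).
  apply/injmP=> s t _ _ /= eq_st; apply/permP=> i.
  by apply: (@lift_inj _ x); rewrite -!(lift_perm_lift x x) eq_st.
rewrite morphimEdom; apply/setP=> s; rewrite inE; apply/imsetP/eqP.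
  by case=> t _ -> /=; rewrite lift_perm_id.
move=> sx; have nx i : x != s (lift x i).
  by rewrite -[X in X != _]sx (inj_eq perm_inj) neq_lift.
(* [f] is [s] with the fixed point [x] deleted; by [nx] the default [i] is never taken. *)
pose f i := odflt i (unlift x (s (lift x i))).
have fE i : lift x (f i) = s (lift x i).
  by rewrite /f; case: unliftP (nx i) => [j -> | ->]; rewrite ?eqxx.
have f_inj : injective f.
  by move=> i j /(congr1 (lift x)); rewrite !fE => /perm_inj/lift_inj.
exists (perm f_inj); rewrite ?inE //=; apply/permP=> i.
case: (unliftP x i) => [j ->|->]; last by rewrite lift_perm_id.
by rewrite lift_perm_lift permE fE.
Qed.

Lemma point2_stab_nudgable (n : nat) (hn : (4 <= n)%N) :
  nudgable (point_stab_group (point2 hn)).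
Proof.
set G := point_stab_group _.
pose i0 : 'I_n := Ordinal (ltnW (ltnW (ltnW hn))).
pose i1 : 'I_n := point2 hn.
pose i2 : 'I_n := Ordinal (ltnW hn).
pose i3 : 'I_n := Ordinal hn.
pose a : 'S_n := tperm i0 i2 * tperm i0 i3.
have aV : a^-1 = tperm i0 i3 * tperm i0 i2 by rewrite invMg !tpermV.
have a0 : a i0 = i2 by rewrite permM tpermL tpermD.
have a1 : a i1 = i1 by rewrite permM !tpermD.
have a2 : a i2 = i3 by rewrite permM tpermR tpermL.
have a3 : a i3 = i0 by rewrite permM (tpermD (z := i3)) // tpermR.
(* [a^-1] sends [i2] to [i0] and [i3] to [i2] and fixes all later points, so its inversions start at
   [i0] or [i1]. *)
have aV_gt1 (i j : 'I_n) : (1 < i)%N -> (i < j)%N -> (a^-1 i < a^-1 j)%N.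
  have aVD (k : 'I_n) : (3 < k)%N -> a^-1 k = k.
    by move=> k3; rewrite aV permM !tpermD // -val_eqE /=; case: (val k) k3 => [|[|[|[|]]]].
  have aV3 : a^-1 i3 = i2 by rewrite -a2 permK.
  move=> i_gt1 ij; have [i_gt3|] := ltnP 3 i.
    by rewrite !aVD // (ltn_trans i_gt3).
  rewrite leq_eqVlt => /orP[/eqP i_3 | i_lt3].
    have -> : i = i3 by apply: val_inj.
    have j_gt3 : (3 < j)%N by rewrite -{1}i_3.
    by rewrite aV3 aVD //; apply: ltnW.
  have -> : i = i2 by apply: val_inj; apply/eqP; rewrite eqn_leq /= i_gt1 -ltnS i_lt3.
  have -> : a^-1 i2 = i0 by rewrite -a0 permK.
  rewrite lt0n; apply/negP => /eqP aVj.
  have /perm_inj ji2 : a^-1 j = a^-1 i2 by rewrite -a0 permK; apply: val_inj.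
  by move: ij; rewrite ji2 /= ltnNge i_gt1.
have stab_aV (s : 'S_n) : s i0 = i0 -> s i1 = i1 -> s \in inv_disjoint G a^-1.
  move=> s0 s1; rewrite !inE s1 eqxx /=; apply/set0Pn => -[[i j]].
  rewrite !inE /= => /andP[/andP[ij sji] /andP[_]]; rewrite ltnNge ltnW //.
  apply: aV_gt1 => //; rewrite ltnNge; apply/negP => i_le1.
  (* Since [s] fixes the two smallest points, neither can be the left end of an inversion of [s]. *)
  have [i_0 | i_1] : i = i0 \/ i = i1.
    by case: i {ij sji} i_le1 => [[|[|]]] // p _; [left|right]; apply: val_inj.
    by rewrite i_0 s0 in sji.
  have /perm_inj j_0 : s j = s i0.
    by rewrite s0; apply: val_inj; move: sji; rewrite i_1 s1 /= ltnS leqn0 => /eqP.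
  by rewrite j_0 in ij.
have Ga : a \in G by rewrite inE; apply/eqP.
move=> /(_ a Ga) eq_card_D.
suff /proper_card : inv_disjoint G a \proper inv_disjoint G a^-1.
  by rewrite eq_card_D ltnn.
apply/properP; split.
  apply/subsetP=> s sDa; have [s0 s1] : s i0 = i0 /\ s i1 = i1; last exact: stab_aV.
  (* As [a] inverts [(i0, i1)], [s] does not: [s i0] is at most 1, and it differs from [s i1], whose
     value is 1. *)
  move: sDa; rewrite !inE => /andP[/eqP s1 /eqP/setP/(_ (i0, i1))].
  rewrite !inE /= a0 a1 s1 andbT => /negbT; rewrite -leqNgt => s0_le1.
  split=> //; apply: val_inj => /=.
  have : s i0 != s i1 by rewrite (inj_eq perm_inj).
  by rewrite s1 -val_eqE /=; case: (nat_of_ord (s i0)) s0_le1 => [|[|]].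
exists (tperm i2 i3); first by apply: stab_aV; rewrite tpermD.
rewrite !inE negb_and; apply/orP; right; apply/set0Pn; exists (i2, i3).
by rewrite !inE /= tpermL tpermR a2 a3.
Qed.

Theorem mainTheorem4 :
  (forall (n : nat) (hn : (4 <= n)%N),
      point_stab (point2 hn) \isog [set: 'S_(n.-1)] /\
      nudgable (point_stab_group (point2 hn))) /\
  (nudgable (point_stab_group (point2 (leqnn 4))) /\
   #|point_stab_group (point2 (leqnn 4))| = 6%N) /\
  (forall (m : nat) (H : {group 'S_m}),
      (1 <= m)%N -> (#|H| < 6)%N -> non_nudgable H).
Proof.
split=> [n hn|]; first by split; [apply: point_stab_isog | apply: point2_stab_nudgable].
split; last by move=> m H _ /card_lt6_abelian/abelian_non_nudgable.
split; first exact: point2_stab_nudgable.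
by rewrite (card_isog (point_stab_isog _)) cardsT card_Sn.
Qed.
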